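(* Let $G=\left\{\begin{pmatrix} a&b\\0&a^{-1}\end{pmatrix}: a>0,\ b\in\mathbb R\right\}$, let $\mu,\lambda\in\mathbb R$, and let $D:G\to G$ be the crossed homomorphism with respect to the conjugation action given by $$D\begin{pmatrix} a&b\\0&a^{-1}\end{pmatrix}=\begin{pmatrix}1&\mu ab+\frac{\lambda}{2}(a^2-1)\\0&1\end{pmatrix}.$$ Let $\mathcal D:G\times\mathbb R\to G$ be a deformation of $D$, and let $\epsilon>0$ and smooth functions $k,m:(-\epsilon,\epsilon)\to\mathbb R$ with $k(0)=\mu$, $m(0)=\lambda$ be such that $$\mathcal D\left(\begin{pmatrix} a&b\\0&a^{-1}\end{pmatrix},s\right)=\begin{pmatrix}1&k(s)ab+\frac{m(s)}{2}(a^2-1)\\0&1\end{pmatrix}\quad\text{for all }\begin{pmatrix} a&b\\0&a^{-1}\end{pmatrix}\in G,\ s\in(-\epsilon,\epsilon).$$ If $k(0)\neq-1$, then the deformation $\mathcal D$ is trivial. If $k(0)=-1$ and $k$ is not flat at $0$, meaning that there exists $l\in\mathbb Z_+$ such that $k^{(n)}(0)=0$ for all $1\le n\le l$ and $k^{(l+1)}(0)\ne0$ (where $k^{(n)}$ is the $n$-th derivative of $k$), then the deformation $\mathcal D$ is nontrivial.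
   Context: $\mathbb Z_+$ denotes the positive integers. A crossed homomorphism with respect to the conjugation action on a Lie group $G$ is a smooth map $D:G\to G$ satisfying $D(xy)=D(x)\,x\,D(y)\,x^{-1}$ for all $x,y\in G$. A deformation of $D$ is a smooth map $\mathcal D:G\times\mathbb R\to G$ such that $\mathcal D(\cdot,0)=D$ and $\mathcal D(\cdot,t)$ is such a crossed homomorphism for every $t\in\mathbb R$. It is trivial if there are an interval $I=(-\varepsilon,\varepsilon)\subset\mathbb R$ and a smooth map $\tau:I\to G$ with $\tau(0)$ the identity and $\mathcal D(x,t)=\tau(t)\,D(x)\,x\,\tau(t)^{-1}\,x^{-1}$ for all $x\in G$, $t\in I$; it is nontrivial if it is not trivial. *)

(* Defs.v *)
From HB Require Import structures.
From mathcomp Require Import all_boot all_order all_algebra.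
From mathcomp Require Import all_classical all_reals all_analysis.

Set Implicit Arguments.
Unset Strict Implicit.
Unset Printing Implicit Defensive.

Import Order.TTheory GRing.Theory Num.Theory.
Import numFieldNormedType.Exports.

Local Open Scope classical_set_scope.
Local Open Scope ring_scope.

(* C^k on an open set U of a finite-dimensional V: f is C^(k+1) when it is
   differentiable and all its directional derivatives are C^k. *)
Fixpoint Ck (R : realType) (V W : normedModType R) (k : nat) (U : set V)
    (f : V -> W) : Prop :=
  match k with
  | 0 => forall x, U x -> {for x, continuous f}
  | k'.+1 => (forall x, U x -> differentiable f x) /\
             forall v : V, Ck k' U (fun x => 'D_v f x)
  end.

(* Smoothness of f restricted to an arbitrary subset X: near every point of X,
   f agrees on X with a map that is C^infinity on an open subset of the ambient
   space.  When X is an embedded submanifold (here: a closed subgroup G of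
   GL_n, G x R, or an open interval) this is smoothness for the manifold
   structure of X.  The values of f outside X are irrelevant. *)
Definition smooth_on (R : realType) (V W : normedModType R) (X : set V)
    (f : V -> W) : Prop :=
  forall x, X x -> exists (U : set V) (g : V -> W),
    [/\ open U, U x, forall k, Ck k U g & forall y, U y -> X y -> f y = g y].

(* In the following definitions, G stands for a closed subgroup of GL_(n+1)(R),
   and maps into or out of G are represented by maps on all matrices, of which
   only the restriction to G is constrained. *)

Definition crossed_hom (R : realType) (n : nat) (G : set 'M[R]_n.+1)
    (D : 'M[R]_n.+1 -> 'M[R]_n.+1) : Prop :=
  [/\ forall x, G x -> G (D x),
      smooth_on G D &
      forall x y, G x -> G y -> D (x * y) = D x * x * D y * x^-1].

Definition deformation (R : realType) (n : nat) (G : set 'M[R]_n.+1)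
    (D : 'M[R]_n.+1 -> 'M[R]_n.+1)
    (DD : 'M[R]_n.+1 -> R -> 'M[R]_n.+1) : Prop :=
  [/\ smooth_on (G `*` [set: R])
        (fun p : ('M[R]_n.+1 * R)%type => DD p.1 p.2),
      forall x, G x -> DD x 0 = D x &
      forall t : R, crossed_hom G (fun x => DD x t)].

Definition trivial_deformation (R : realType) (n : nat) (G : set 'M[R]_n.+1)
    (D : 'M[R]_n.+1 -> 'M[R]_n.+1)
    (DD : 'M[R]_n.+1 -> R -> 'M[R]_n.+1) : Prop :=
  exists (e : R) (tau : R -> 'M[R]_n.+1),
    [/\ 0 < e,
        smooth_on `]- e, e[ tau,
        forall t, t \in `]- e, e[ -> G (tau t),
        tau 0 = 1 &
        forall x t, G x -> t \in `]- e, e[ ->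
          DD x t = tau t * D x * x * (tau t)^-1 * x^-1].

Definition uptri (R : realType) (a b d : R) : 'M[R]_2 :=
  \matrix_(i, j) if i == 0 then (if j == 0 then a else b)
                 else (if j == 0 then 0 else d).

Definition affG (R : realType) : set 'M[R]_2 :=
  [set x | exists a b : R, 0 < a /\ x = uptri a b a^-1].

(* Main.v *)
Require Import Defs.
From HB Require Import structures.
From mathcomp Require Import all_boot all_order all_algebra.
From mathcomp Require Import all_classical all_reals all_analysis.
From mathcomp Require Import ring.
Import Order.TTheory GRing.Theory Num.Theory.
Import numFieldNormedType.Exports.
Local Open Scope classical_set_scope.
Local Open Scope ring_scope.

(** Let tau(s) have entries (p, q; 0, 1/p), with p > 0, and put A = p^2, B = p q. Comparing
    tau D(x) x tau^-1 x^-1, computed in [uptri_twisted_conj], with the given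
    form of the deformation, as polynomials in a b and a^2 - 1, shows that tau
    trivializes the deformation if and only if

      k(s) + 1 = A(s) (mu + 1)   and   m(s) = A(s) lambda - 2 B(s).

    If mu <> -1, these equations determine A = (1 + k) / (1 + mu) and
    B = (A lambda - m) / 2. Since A(0) = 1 and k is continuous, A is positive
    on a small interval, and there p = A^(1/2) and q = B A^(-1/2) define a
    smooth curve in G; it starts at the identity as B(0) = 0. Its smoothness
    comes from the rules [CkM] and [Ck_powR], transported to matrices by
    [Ck_uptri].

    If mu = -1, the first equation forces k = -1 near 0, so that all derivatives
    of k vanish at 0 ([near_cst_derive1nS]) and k is flat. *)

(** * Calculus of C^k functions *)

(** Differentiability at x is an expansion up to o(h), which only sees the germ
    at x; the two functions even have the same differential. *)
Lemma near_eq_differentiable {R : realType} {V W : normedModType R}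
    {f g : V -> W} (x : V) :
  (\forall y \near x, f y = g y) -> differentiable f x -> differentiable g x.
Proof.
move=> fg df; have fgx := nbhs_singleton fg.
have dfc : continuous ('d f x) by exact: diff_continuous.
have gE : g \o shift x = cst (g x) + 'd f x +o_ 0 id.
  apply/eqaddoP => /= eps eps0.
  have /eqaddoP/(_ eps eps0) := diff_locally df.
  apply: filterS2; last first.
    by have := fg; rewrite (near_shift 0) subr0; apply.
  by move=> h /= fgh; rewrite !fctE/= fgh fgx.
by apply/diff_locallyP; rewrite (diff_unique dfc gE).
Qed.

Lemma Ck_sub {R : realType} {V W : normedModType R} {n : nat} {U U' : set V}
    {f : V -> W} : U' `<=` U -> Ck n U f -> Ck n U' f.
Proof.
move=> UU'; elim: n f => [|n IH] f /=; first by move=> cf x /UU'; exact: cf.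
by case=> df Df; split=> [x /UU'|v]; [exact: df|exact: IH].
Qed.

(** [Ck n X f] only speaks of f and its iterated directional derivatives at the
    points of X, one point at a time: this is what glues the local extensions
    supplied by [smooth_on]. *)
Lemma Ck_local {R : realType} {V W : normedModType R} {n : nat} {X : set V}
    {f : V -> W} :
  (forall x, X x -> exists2 U : set V, U x & Ck n U f) -> Ck n X f.
Proof.
elim: n f => [|n IH] f /= loc.
  by move=> x /loc[U Ux]; apply.
split=> [x /loc[U Ux [+ _]]|v]; first exact.
by apply: IH => x /loc[U Ux [_ Df]]; exists U.
Qed.

(** Openness of U lets one replace f by any formula valid on U only. The
    rules for sums, products and powers rely on it, since their formulas for the
    directional derivatives hold only where the functions are differentiable. *)
Lemma Ck_eq {R : realType} {V W : normedModType R} {n : nat} {U : set V}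
    {f g : V -> W} : open U -> {in U, f =1 g} -> Ck n U f -> Ck n U g.
Proof.
move=> oU.
have near_fg f' g' x : {in U, f' =1 g'} -> U x ->
    \forall y \near x, f' y = g' y.
  by move=> fg Ux; apply: filterS (open_nbhs_nbhs (conj oU Ux)) => y Uy;
    rewrite fg ?inE.
elim: n f g => [|n IH] f g fg /=.
  move=> cf x Ux; rewrite /prop_for /continuous_at -fg ?inE//.
  by apply: cvg_trans (cf x Ux); apply: near_eq_cvg; exact: near_fg.
case=> df Df; split=> [x Ux|v].
  by apply: near_eq_differentiable (df x Ux); exact: near_fg.
apply: IH (Df v) => x; rewrite inE => Ux.
by apply: near_eq_derive; exact: near_fg.
Qed.

Lemma CkS_Ck {R : realType} {V W : normedModType R} {n : nat} {U : set V}
    {f : V -> W} : Ck n.+1 U f -> Ck n U f.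
Proof.
elim: n f => [|n IH] f.
  by case=> df _ x /df; exact: differentiable_continuous.
by case=> df Df; split=> // v; exact: IH.
Qed.

Lemma Ck_smooth_on {R : realType} {V W : normedModType R} {X : set V}
    {f : V -> W} : open X -> (forall n, Ck n X f) -> smooth_on X f.
Proof. by move=> oX Cf x Xx; exists X, f. Qed.

(** On an open set the local extensions in [smooth_on] can be taken to be f
    itself, so smoothness there is just being C^n for all n. This makes the
    rules for sums, products and powers applicable to f. *)
Lemma smooth_on_Ck {R : realType} {V W : normedModType R} {X : set V}
    {f : V -> W} {n : nat} : open X -> smooth_on X f -> Ck n X f.
Proof.
move=> oX sf; apply: Ck_local => x Xx.
have [U [g [oU Ux Cg fg]]] := sf x Xx.
exists (U `&` X) => //; apply: (@Ck_eq _ _ _ _ _ g).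
- exact: openI.
- by move=> y; rewrite inE => -[Uy Xy]; rewrite fg.
- by apply: Ck_sub (Cg n) => y [].
Qed.

Lemma Ck_cst {R : realType} {V W : normedModType R} {n : nat} {U : set V}
    (w : W) : Ck n U (fun=> w).
Proof.
elim: n w => [|n IH] w /=; first by move=> x _; exact: cst_continuous.
split=> [x _|v]; first exact: differentiable_cst.
have -> : (fun x : V => 'D_v (fun=> w) x) = (fun=> 0).
  by apply/funext => x; rewrite (derive_cst w).
exact: IH.
Qed.

Lemma CkD {R : realType} {V W : normedModType R} {n : nat} {U : set V}
    {f g : V -> W} :
  open U -> Ck n U f -> Ck n U g -> Ck n U (fun x => f x + g x).
Proof.
move=> oU; elim: n f g => [|n IH] f g /=.
  by move=> cf cg x Ux; apply: cvgD; [exact: cf|exact: cg].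
case=> df Df [dg Dg]; split=> [x Ux|v].
  by apply: differentiableD; [exact: df|exact: dg].
apply: Ck_eq (IH _ _ (Df v) (Dg v)) => // x; rewrite inE => Ux.
by rewrite (@deriveD _ _ _ f g)//; apply: diff_derivable; [exact: df|exact: dg].
Qed.

Lemma CkM {R : realType} {V : normedModType R} {n : nat} {U : set V}
    {f g : V -> R} :
  open U -> Ck n U f -> Ck n U g -> Ck n U (fun x => f x * g x).
Proof.
move=> oU; elim: n f g => [|n IH] f g.
  by move=> cf cg x Ux; apply: cvgM; [exact: cf|exact: cg].
move=> Cf Cg; have [df Df] := Cf; have [dg Dg] := Cg; split=> [x Ux|v].
  by apply: differentiableM; [exact: df|exact: dg].
apply: Ck_eq (CkD oU (IH _ _ (CkS_Ck Cf) (Dg v))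
    (IH _ _ (CkS_Ck Cg) (Df v))) => // x; rewrite inE => Ux.
by rewrite (@deriveM _ _ f g)//; apply: diff_derivable; [exact: df|exact: dg].
Qed.

Lemma CkZl {R : realType} {V W : normedModType R} {n : nat} {U : set V}
    {f : V -> R} (w : W) :
  open U -> Ck n U f -> Ck n U (fun x => f x *: w).
Proof.
move=> oU; elim: n f => [|n IH] f /=.
  by move=> cf x Ux; apply: cvgZ; [exact: cf|exact: cvg_cst].
case=> df Df; split=> [x Ux|v].
  by apply: differentiableZl; exact: df.
apply: Ck_eq (IH _ (Df v)) => // x; rewrite inE => Ux.
have dfx := df _ Ux.
by rewrite !deriveE ?diffZl//; exact: differentiableZl.
Qed.

(** Induction on the order of smoothness, for all exponents at once: the
    derivative of a power of f is again a product involving a power of f, with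
    another exponent. Square roots and their inverses are thus covered without
    separate rules for inversion and composition. *)
Lemma Ck_powR {R : realType} {V : normedModType R} {n : nat} {U : set V}
    {f : V -> R} (a : R) :
  open U -> (forall x, U x -> 0 < f x) -> Ck n U f ->
  Ck n U (fun x => f x `^ a).
Proof.
move=> oU f0; have dpow b x : U x -> differentiable (@powR R ^~ b) (f x).
  by move=> Ux; apply/derivable1_diffP; apply: derivable_powR;
     rewrite in_itv/= f0.
elim: n a => [|n IH] a Cf.
  move=> x Ux; apply: (@continuous_comp _ _ _ f (@powR R ^~ a)); first exact: Cf.
  exact/differentiable_continuous/dpow.
have [df Df] := Cf; split=> [x Ux|v].
  apply: (@differentiable_comp _ _ _ _ f (@powR R ^~ a)); first exact: df.
  exact: dpow.
(* The derivative is D_v f * (a * f `^ (a - 1)); the last power of f is C^n by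
   the induction hypothesis at the exponent a - 1. *)
apply: Ck_eq (CkM oU (Df v) (CkM oU (Ck_cst a)
  (IH (a - 1) (CkS_Ck Cf)))) => // x; rewrite inE => Ux.
have dfx := df _ Ux.
rewrite !deriveE//; last first.
  by apply: (@differentiable_comp _ _ _ _ f (@powR R ^~ a)) => //; exact: dpow.
rewrite (diff_comp (g := @powR R ^~ a) dfx)/=; last exact: dpow.
rewrite diff1E; last exact: dpow.
by rewrite powR_derive1// in_itv/= f0.
Qed.

(** Being constant near x holds near every point close to x, so the derivative
    is itself locally constant, equal to 0, and the induction goes on with it.
    For the function k this is what contradicts non-flatness. *)
Lemma near_cst_derive1nS {R : realType} {W : normedModType R} (n : nat)
    {f : R -> W} {c : W} {x : R} :
  (\forall y \near x, f y = c) -> derive1n n.+1 f x = 0.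
Proof.
elim: n f c => [|n IH] f c fc.
  by rewrite derive1n1 derive1E (near_eq_derive _ (g := cst c))// derive_cst.
rewrite derive1Sn; apply: (IH _ 0).
apply: filterS (nbhs_interior fc) => y fcy.
by rewrite derive1E (near_eq_derive _ (g := cst c))// derive_cst.
Qed.

(** * Upper triangular matrices *)

Lemma uptriM {R : realType} (a b d a' b' d' : R) :
  uptri a b d * uptri a' b' d' = uptri (a * a') (a * b' + b * d') (d * d').
Proof.
apply/matrixP => i j; rewrite -mulmxE !mxE !big_ord_recl big_ord0 !mxE /=.
case: (unliftP 0 i) => [i' ->|->]; case: (unliftP 0 j) => [j' ->|->] //=;
  by rewrite ?(mulr0, mul0r, addr0, add0r).
Qed.

Lemma uptri1 {R : realType} : uptri 1 0 1 = 1 :> 'M[R]_2.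
Proof.
apply/matrixP => i j; rewrite !mxE.
by case: i => [[|[]]//= ?]; case: j => [[|[]]//= ?].
Qed.

Lemma uptri_inj {R : realType} {a b d a' b' d' : R} :
  uptri a b d = uptri a' b' d' -> [/\ a = a', b = b' & d = d'].
Proof.
move/matrixP => E; split.
- by have := E 0 0; rewrite !mxE.
- by have := E 0 1; rewrite !mxE.
- by have := E 1 1; rewrite !mxE.
Qed.

Lemma uptriV {R : realType} (a b : R) : a != 0 ->
  (uptri a b a^-1)^-1 = uptri a^-1 (- b) a.
Proof.
move=> a0.
have E : uptri a b a^-1 * uptri a^-1 (- b) a = 1.
  by rewrite uptriM mulfV// mulVf// mulrN mulrC addrC subrr uptri1.
have [U _] := mulmx1_unit E.
by rewrite -[RHS]mul1r -(mulVr U) -mulrA E mulr1.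
Qed.

(** A matrix (a, b; 0, 1/a) acts on the line by the affine map
    z |-> a^2 z + a b. On the left-hand side the linear parts p^2 and a^2
    cancel against those of the inverses, so the composite is a translation; its
    length is found by following a point through the five maps. *)
Lemma uptri_twisted_conj {R : realType} (p q a b c : R) : p != 0 -> a != 0 ->
  uptri p q p^-1 * uptri 1 c 1 * uptri a b a^-1 * (uptri p q p^-1)^-1
    * (uptri a b a^-1)^-1
  = uptri 1 (p ^+ 2 * c + (p ^+ 2 - 1) * (a * b) - p * q * (a ^+ 2 - 1)) 1.
Proof.
move=> p0 a0; rewrite !uptriV// !uptriM; congr uptri; field; exact/andP.
Qed.

(** Reduces smoothness of a curve of matrices to that of its entries. *)
Lemma uptri_lin {R : realType} (a b d : R) :
  uptri a b d = a *: uptri 1 0 0 + b *: uptri 0 1 0 + d *: uptri 0 0 1.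
Proof.
apply/matrixP => i j; rewrite !mxE.
by case: ifP => _; case: ifP => _; rewrite ?(mulr0, mulr1, addr0, add0r).
Qed.

Lemma Ck_uptri {R : realType} {V : normedModType R} {n : nat} {U : set V}
    {f g h : V -> R} : open U -> Ck n U f -> Ck n U g -> Ck n U h ->
  Ck n U (fun x => uptri (f x) (g x) (h x)).
Proof.
move=> oU Cf Cg Ch; under eq_fun do rewrite uptri_lin.
by apply: CkD => //; [apply: CkD => //|]; apply: CkZl.
Qed.

(** * Triviality of the deformation *)

Theorem theorem4p4 (R : realType) (mu lambda : R) (D : 'M[R]_2 -> 'M[R]_2)
    (hD : forall a b : R, 0 < a ->
      D (uptri a b a^-1) =
        uptri 1 (mu * a * b + lambda / 2 * (a ^+ 2 - 1)) 1)
    (DD : 'M[R]_2 -> R -> 'M[R]_2)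
    (hDD : deformation (@affG R) D DD)
    (e : R) (he : 0 < e) (k m : R -> R)
    (hk : smooth_on `]- e, e[ k) (hm : smooth_on `]- e, e[ m)
    (hk0 : k 0 = mu) (hm0 : m 0 = lambda)
    (hkm : forall a b s : R, 0 < a -> s \in `]- e, e[ ->
      DD (uptri a b a^-1) s =
        uptri 1 (k s * a * b + m s / 2 * (a ^+ 2 - 1)) 1) :
  (k 0 <> -1 -> trivial_deformation (@affG R) D DD) /\
  (k 0 = -1 ->
   (exists l : nat,
      [/\ (0 < l)%N,
          forall n : nat, (1 <= n <= l)%N -> derive1n n k 0 = 0 &
          derive1n l.+1 k 0 <> 0]) ->
   ~ trivial_deformation (@affG R) D DD).
Proof.
have oI r : open (`]- r, r[%classic : set R) by exact: interval_open.
have I0 r : 0 < r -> (0 : R) \in `]- r, r[.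
  by move=> r0; rewrite in_itv/= oppr_lt0 r0.
split=> [k1|k1 [l [_ _ kl]] [e' [tau [e'0 _ Gtau _ tauE]]]].
- have mu1 : 1 + mu != 0.
    by apply/eqP => /eqP; rewrite addrC addr_eq0 -hk0 => /eqP.
  pose A s := (1 + k s) / (1 + mu).
  pose B s := (A s * lambda - m s) / 2.
  have CA n : Ck n (`]- e, e[%classic) A.
    apply: CkM (Ck_cst _) => //; apply: CkD (Ck_cst _) _ => //.
    exact: smooth_on_Ck.
  have CB n : Ck n (`]- e, e[%classic) B.
    apply: CkM (Ck_cst _) => //; apply: CkD => //; first exact: CkM (Ck_cst _).
    have -> : (fun s => - m s) = (fun s => -1 * m s).
      by apply/funext => s; rewrite mulN1r.
    by apply: (CkM (oI e) (Ck_cst (-1 : R))); exact: smooth_on_Ck.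
  have A0 : A 0 = 1 by rewrite /A hk0 divff.
  have Apos : \forall s \near (0 : R), 0 < A s /\ s \in `]- e, e[.
    near=> s; split; near: s.
      by apply: (cvgr_gt _ (CA 0 0 (I0 e he))); rewrite A0.
    by apply: near_in_itvoo; exact: I0.
  have [e' /= e'0 He'] := (nbhs_ballP _ _).1 Apos.
  have {}He' t : t \in `]- e', e'[ -> 0 < A t /\ t \in `]- e, e[.
    move=> te'; apply: He'; rewrite /ball/= sub0r normrN ltr_norml.
    by move: te'; rewrite in_itv.
  exists e', (fun t => uptri (A t `^ 2^-1) (B t * A t `^ (- 2^-1))
                         (A t `^ (- 2^-1))).
  split=> //.
  + apply: Ck_smooth_on => // n.
    have CA' : Ck n (`]- e', e'[%classic) A by apply: Ck_sub (CA n) => t /He'[].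
    have CB' : Ck n (`]- e', e'[%classic) B by apply: Ck_sub (CB n) => t /He'[].
    have CP a : Ck n (`]- e', e'[%classic) (fun t => A t `^ a).
      by apply: Ck_powR => // t /He'[].
    by apply: Ck_uptri => //; exact: CkM.
  + move=> t /He'[At _]; exists (A t `^ 2^-1), (B t * A t `^ (- 2^-1)).
    by rewrite powR_gt0// powRN.
  + by rewrite /B A0 hm0 mul1r subrr !mul0r !powR1 uptri1.
  + move=> _ t [a [b [a0 ->]]] /He'[At te].
    rewrite hkm// hD// powRN uptri_twisted_conj ?gt_eqF ?powR_gt0//.
    congr uptri; rewrite powR12_sqrt ?ltW// sqr_sqrtr ?ltW//.
    rewrite [_ * (B t / _)]mulrCA divff ?gt_eqF ?sqrtr_gt0// mulr1.
    rewrite /B /A; field; exact: mu1.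
- apply: kl; apply: (near_cst_derive1nS l (c := -1 : R)).
  near=> s.
  have se : s \in `]- e, e[ by near: s; apply: near_in_itvoo; exact: I0.
  have se' : s \in `]- e', e'[ by near: s; apply: near_in_itvoo; exact: I0.
  have [p [q [p0 tauEs]]] := Gtau s se'.
  have Gx : affG (uptri 1 1 1^-1 : 'M[R]_2) by exists 1, 1; rewrite ltr01.
  (* The coefficient k(s) is read off at a = b = 1, where a^2 - 1 = 0. *)
  have := tauE _ s Gx se'.
  rewrite hkm// hD// tauEs uptri_twisted_conj ?gt_eqF// -hk0 k1.
  case/uptri_inj => _ + _.
  rewrite !expr1n subrr !mulr0 !mulr1 !addr0 subr0 => ->; ring.
Unshelve. all: by end_near.
Qed.
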